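(* Let $k$ be a positive integer. There exists an algorithm that, given a DFA $\mathcal{A}=(Q,\Sigma)$, decides the winner in the $k$-game on $\mathcal{A}$ in $O(|Q|^4\cdot|\Sigma|)$ time.
   Context: A DFA $\mathcal{A}=(Q,\Sigma)$ consists of finite nonempty sets $Q$ (states) and $\Sigma$ (letters) with a map $Q\times\Sigma\to Q$, $(q,a)\mapsto q\cdot a$, extended to words by $q\cdot\varepsilon=q$, $q\cdot(wa)=(q\cdot w)\cdot a$, and to subsets by $P\cdot w=\{p\cdot w:p\in P\}$. All DFAs considered have at least three states. A word $w$ is a reset word for $\mathcal{A}$ if $|Q\cdot w|=1$. For a positive integer $k$, the $k$-game on $\mathcal{A}$: two players, Alice and Bob, alternate moves. On each of her turns Alice chooses a letter of $\Sigma$; on each of his turns Bob chooses a word over $\Sigma$ of length less than $k$ (possibly empty). The history of the game up to a turn is the concatenation, in order, of all letters and words chosen so far. Alice wins if at some turn the history is a reset word for $\mathcal{A}$; Bob wins if the game continues forever. (It does not matter who moves first.) Deciding the winner means deciding which player has a winning strategy. The DFA is given by its transition table, and time is measured in the usual unit-cost random-access model. *)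

(* Defs.v *)
From mathcomp Require Import all_boot.

Set Implicit Arguments.
Unset Strict Implicit.
Unset Printing Implicit Defensive.

(** * Automata and reset words *)

Definition dfa (Q Sigma : finType) : Type := Q -> Sigma -> Q.

Definition run (Q Sigma : finType) (A : dfa Q Sigma) (q : Q) (w : seq Sigma) : Q :=
  foldl A q w.

Definition run_set (Q Sigma : finType) (A : dfa Q Sigma) (P : {set Q})
    (w : seq Sigma) : {set Q} :=
  [set run A p w | p in P].

Definition reset_word (Q Sigma : finType) (A : dfa Q Sigma) (w : seq Sigma) : bool :=
  #|run_set A [set: Q] w| == 1.

(** * The k-game *)

Inductive player := Alice | Bob.

Definition opponent (p : player) : player :=
  match p with Alice => Bob | Bob => Alice end.

(* The player who makes the move number [t] (counted from 0). *)
Definition mover (first : player) (t : nat) : player :=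
  if odd t then opponent first else first.

(* A strategy sees the list of all the moves made so far, in order, where a
   move is a word; a move of Alice is a one-letter word. *)
Definition alice_strategy (Sigma : finType) : Type := seq (seq Sigma) -> Sigma.

Definition bob_strategy (Sigma : finType) (k : nat) : Type :=
  seq (seq Sigma) -> {w : seq Sigma | size w < k}.

(* The first [t] moves.  Plays are prolonged after a win of Alice; this does
   not affect who wins, since only the existence of a winning turn matters. *)
Fixpoint moves (Sigma : finType) (k : nat) (first : player)
    (sA : alice_strategy Sigma) (sB : bob_strategy Sigma k) (t : nat)
    : seq (seq Sigma) :=
  if t is t'.+1 then
    let h := moves first sA sB t' in
    rcons h (match mover first t' with
             | Alice => [:: sA h]
             | Bob => val (sB h)
             end)
  else [::].

Definition history (Sigma : finType) (k : nat) (first : player)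
    (sA : alice_strategy Sigma) (sB : bob_strategy Sigma k) (t : nat) : seq Sigma :=
  flatten (moves first sA sB t).

Definition alice_wins_play (Q Sigma : finType) (A : dfa Q Sigma) (k : nat)
    (first : player) (sA : alice_strategy Sigma) (sB : bob_strategy Sigma k) : Prop :=
  exists t : nat, reset_word A (history first sA sB t).

Definition bob_wins_play (Q Sigma : finType) (A : dfa Q Sigma) (k : nat)
    (first : player) (sA : alice_strategy Sigma) (sB : bob_strategy Sigma k) : Prop :=
  forall t : nat, ~~ reset_word A (history first sA sB t).

Definition has_winning_strategy (Q Sigma : finType) (A : dfa Q Sigma) (k : nat)
    (first p : player) : Prop :=
  match p with
  | Alice => exists sA : alice_strategy Sigma, forall sB : bob_strategy Sigma k,
               alice_wins_play A first sA sB
  | Bob => exists sB : bob_strategy Sigma k, forall sA : alice_strategy Sigma,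
               bob_wins_play A first sA sB
  end.

(** * Unit-cost random-access machines *)

(* A machine has directly addressed registers, and a memory which is accessed
   only indirectly, at an address held in a register.  Both hold natural
   numbers.  Multiplication is left out since, at unit cost, it would make
   arithmetic on long integers unrealistically powerful. *)
Inductive instr :=
  | Const of nat & nat          (* Const r v   : r := v *)
  | Move of nat & nat           (* Move r s    : r := s *)
  | Add of nat & nat & nat      (* Add r s t   : r := s + t *)
  | Sub of nat & nat & nat      (* Sub r s t   : r := s - t, truncated at 0 *)
  | Read of nat & nat           (* Read r s    : r := mem[s] *)
  | Write of nat & nat          (* Write r s   : mem[r] := s *)
  | Jump of nat                 (* Jump l      : goto l *)
  | JumpZ of nat & nat          (* JumpZ r l   : if r = 0 then goto l *)
  | Halt.

Definition program : Type := seq instr.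

Record config := Config {
  pc : nat;
  reg : nat -> nat;
  memory : nat -> nat
}.

Definition update (f : nat -> nat) (i v : nat) : nat -> nat :=
  fun j => if j == i then v else f j.

(* [None] means that the machine has halted, either on [Halt] or because the
   program counter has left the program. *)
Definition step (P : program) (c : config) : option config :=
  let: Config l R M := c in
  match onth P l with
  | Some (Const r v) => Some (Config l.+1 (update R r v) M)
  | Some (Move r s) => Some (Config l.+1 (update R r (R s)) M)
  | Some (Add r s t) => Some (Config l.+1 (update R r (R s + R t)) M)
  | Some (Sub r s t) => Some (Config l.+1 (update R r (R s - R t)) M)
  | Some (Read r s) => Some (Config l.+1 (update R r (M (R s))) M)
  | Some (Write r s) => Some (Config l.+1 R (update M (R r) (R s)))
  | Some (Jump l') => Some (Config l' R M)
  | Some (JumpZ r l') => Some (Config (if R r == 0 then l' else l.+1) R M)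
  | Some Halt | None => None
  end.

Definition steps (P : program) (t : nat) (c : config) : option config :=
  iter t (obind (step P)) (Some c).

(* Started from [c], the machine executes exactly [t] instructions, halts, and
   leaves [out] in register 0. *)
Definition halts_in (P : program) (c : config) (t out : nat) : Prop :=
  exists c' : config,
    [/\ steps P t c = Some c', step P c' = None & reg c' 0 = out].

(* The transition table in row-major order, states and letters being numbered
   from 0: the entry of the state number i and the letter number j is at the
   position i * #|Sigma| + j. *)
Definition table (Q Sigma : finType) (A : dfa Q Sigma) : seq nat :=
  [seq (enum_rank (A q a) : nat) | q <- enum Q, a <- enum Sigma].

(* Registers 0 and 1 hold #|Q| and #|Sigma|, the memory holds the transition
   table from address 0 on; everything else is 0. *)
Definition input (Q Sigma : finType) (A : dfa Q Sigma) : config :=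
  Config 0 (nth 0 [:: #|Q|; #|Sigma|]) (nth 0 (table A)).

Definition player_code (p : player) : nat :=
  match p with Alice => 1 | Bob => 0 end.

(* Main.v *)
(* Alice wins from all of Q iff she can merge every pair of states: she merges
   pairs one after the other, and Bob survives as soon as one pair can be kept
   apart.  The pairs that Alice can merge are obtained by iterating, from the
   diagonal, the operator that adds the pairs from which some letter leads to a
   pair that no word of length less than k takes out of the current set.  This
   stabilises within |Q|^2 rounds, and a round costs O(k |Q|^2 |Sigma|) when the
   transition table of the pair automaton is available, whence the bound.

   The machine numbers the pairs by p * |Q| + q and represents a set of pairs by
   an array vanishing exactly on that set.  Then "V(x) = 0 and B(x.a) = 0 for all
   a" is V(x) + sum_a B(x.a) = 0, and, if V(x) <= 1, "V(x) = 0 or B(x.a) = 0 for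
   some a" is V(x) - sum_a (1 - B(x.a)) = 0 with truncated subtractions, so no
   branching is needed.  Every new array is written in fresh memory. *)

Require Import Defs.
From mathcomp Require Import all_boot zify.

Set Implicit Arguments.
Unset Strict Implicit.
Unset Printing Implicit Defensive.

(** * A structured language compiled to the machine *)

Inductive cmd :=
  | Blk of seq instr
  | Seq of cmd & cmd
  | For of nat & cmd.

Fixpoint csize (c : cmd) : nat :=
  match c with
  | Blk s => size s
  | Seq c1 c2 => csize c1 + csize c2
  | For _ c1 => csize c1 + 4
  end.

(* Register 11 is reserved: every iteration of a loop starts by setting it to 1. *)
Fixpoint compile (l : nat) (c : cmd) : program :=
  match c with
  | Blk s => s
  | Seq c1 c2 => compile l c1 ++ compile (l + csize c1) c2
  | For r c1 => [:: JumpZ r (l + (csize c1 + 4)); Const 11 1; Defs.Sub r r 11]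
                  ++ compile (l + 3) c1 ++ [:: Jump l]
  end.

Lemma size_compile c l : size (compile l c) = csize c.
Proof.
elim: c l => [s|c1 IH1 c2 IH2|r c1 IH] l //=; first by rewrite size_cat IH1 IH2.
by rewrite size_cat IH /= !addnS addn0.
Qed.

Definition code_at (P : program) (l : nat) (s : program) : Prop :=
  forall i, i < size s -> onth P (l + i) = onth s i.

Lemma code_at_cat P l s1 s2 :
  code_at P l (s1 ++ s2) -> code_at P l s1 /\ code_at P (l + size s1) s2.
Proof.
move=> H; split=> i Hi.
  by rewrite H ?size_cat ?ltn_addr // onth_cat Hi.
by rewrite -addnA H ?size_cat ?ltn_add2l // onth_cat ltnNge leq_addr addKn.
Qed.

Definition straight (i : instr) : bool :=
  match i with Jump _ | JumpZ _ _ | Halt => false | _ => true end.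

Definition exec_reg (i : instr) (R M : nat -> nat) : nat -> nat :=
  match i with
  | Const r v => update R r v
  | Move r s => update R r (R s)
  | Add r s t => update R r (R s + R t)
  | Defs.Sub r s t => update R r (R s - R t)
  | Read r s => update R r (M (R s))
  | _ => R
  end.

Definition exec_mem (i : instr) (R M : nat -> nat) : nat -> nat :=
  if i is Write r s then update M (R r) (R s) else M.

Fixpoint blk_post (s : seq instr) (Q : (nat -> nat) -> (nat -> nat) -> Prop) R M :=
  if s is i :: s' then blk_post s' Q (exec_reg i R M) (exec_mem i R M) else Q R M.

(** Total correctness within [t] instructions. Quantifying over every program that contains the code
    at [l] lets fragments with absolute jump targets be verified alone and then composed. *)
Definition wp (c : cmd) (Q : (nat -> nat) -> (nat -> nat) -> Prop) (t : nat)
    (R M : nat -> nat) : Prop :=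
  forall P l, code_at P l (compile l c) ->
  exists u R' M', [/\ u <= t,
    steps P u (Config l R M) = Some (Config (l + csize c) R' M') & Q R' M'].

Lemma steps_trans P u v c c' :
  steps P u c = Some c' -> steps P (v + u) c = steps P v c'.
Proof. by rewrite /steps iterD => ->. Qed.

Lemma steps_cons P v c c' : step P c = Some c' -> steps P v.+1 c = steps P v c'.
Proof. by move=> H; rewrite -addn1; apply: steps_trans. Qed.

Lemma wp_mono c Q Q' t t' R M :
  wp c Q t R M -> t <= t' -> (forall R M, Q R M -> Q' R M) -> wp c Q' t' R M.
Proof.
move=> H tt' QQ' P l /H [u [R' [M' [ut Hu HQ]]]].
by exists u, R', M'; split; [exact: leq_trans tt' | | exact: QQ'].
Qed.

Lemma wp_blk s Q t R M :
  all straight s -> size s <= t -> blk_post s Q R M -> wp (Blk s) Q t R M.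
Proof.
move=> Hs st HQ; suff H : wp (Blk s) Q (size s) R M by apply: wp_mono H st _.
move=> P l /= {st}.
elim: s l R M Hs HQ => [|i s IH] l R M /= Hs HQ HP.
  by exists 0, R, M; split=> //; rewrite addn0.
case/andP: Hs => Hi Hs.
have Hstep : step P (Config l R M) = Some (Config l.+1 (exec_reg i R M) (exec_mem i R M)).
  have /= := HP 0 isT; rewrite addn0 /step => ->.
  by case: i Hi {HQ HP}.
have [|u [R' [M' [ut Hu HQ']]]] := IH l.+1 _ _ Hs HQ.
  by move=> j Hj; have := HP j.+1; rewrite addnS => ->.
exists u.+1, R', M'; split=> //.
by rewrite (steps_cons _ Hstep) Hu addnS addSn.
Qed.

Lemma wp_seq c1 c2 Q t1 t2 R M :
  wp c1 (wp c2 Q t2) t1 R M -> wp (Seq c1 c2) Q (t1 + t2) R M.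
Proof.
move=> H P l /= /code_at_cat [H1 H2].
have [u1 [R1 [M1 [Hu1 E1 W1]]]] := H P l H1.
rewrite size_compile in H2.
have [u2 [R2 [M2 [Hu2 E2 HQ]]]] := W1 P _ H2.
exists (u2 + u1), R2, M2; split=> //; first by rewrite addnC leq_add.
by rewrite (steps_trans _ E1) E2 addnA.
Qed.

(** [I i] is the invariant after [i] iterations. The counter is decremented before the body, which
    may use it as long as it restores it. The 4 counts the test, the two instructions of the
    decrement and the jump back; the final 1 is the failing test. *)
Lemma wp_for r c Q (I : nat -> (nat -> nat) -> (nat -> nat) -> Prop) tb n R M :
  r != 11 -> R r = n -> I 0 R M ->
  (forall i R M, i < n -> I i R M ->
     wp c (fun R' M' => R' r = n - i.+1 /\ I i.+1 R' M') tb
        (update (update R 11 1) r (n - i.+1)) M) ->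
  (forall R M, I n R M -> Q R M) ->
  wp (For r c) Q (n * (tb + 4) + 1) R M.
Proof.
move=> r11 Rr I0 Hb HQ P l HP.
have /= HPj := HP 0 isT; have /= HPc := HP 1 isT; have /= HPs := HP 2 isT.
have [_ /code_at_cat [HPb HPe]] := code_at_cat HP.
rewrite size_compile /= in HPe HPb.
have {HPe} := HPe 0 isT; rewrite addn0 => HPe.
rewrite addn0 in HPj; rewrite addn1 in HPc; rewrite addn2 in HPs.
(* Induction runs on the number [j] of remaining iterations, which is the content of the counter. *)
suff main j R1 M1 : j <= n -> R1 r = j -> I (n - j) R1 M1 ->
   exists u R' M', [/\ u <= j * (tb + 4) + 1,
    steps P u (Config l R1 M1) = Some (Config (l + csize (For r c)) R' M') & Q R' M'].
  by apply: main => //; rewrite subnn.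
elim: j R1 M1 => [|j IH] R1 M1 jn Rj Ij.
  exists 1, R1, M1; split=> //; last by apply: HQ; rewrite subn0 in Ij.
  by rewrite /steps /= HPj Rj.
have Hlt : n - j.+1 < n by lia.
have En : n - (n - j.+1).+1 = j by lia.
have [u [R2 [M2 [Hu E2 [Rr2 I2]]]]] := Hb _ _ _ Hlt Ij P _ HPb.
rewrite En in Rr2 E2; rewrite (_ : (n - j.+1).+1 = n - j) in I2; last by lia.
have [v [R3 [M3 [Hv E3 HQ3]]]] := IH R2 M2 (ltnW jn) Rr2 I2.
exists (v + 1 + u).+3, R3, M3; split=> //; first by rewrite mulSn; lia.
rewrite (@steps_cons _ _ _ (Config l.+1 R1 M1)); last by rewrite /step HPj Rj.
rewrite (@steps_cons _ _ _ (Config l.+2 (update R1 11 1) M1)); last by rewrite /step HPc.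
rewrite (@steps_cons _ _ _ (Config (l+3) (update (update R1 11 1) r j) M1)); last first.
  rewrite /step HPs /update (negbTE r11) eqxx Rj addn3; congr (Some (Config _ _ _)).
  by rewrite subSS subn0.
rewrite (steps_trans _ E2) addn1 (@steps_cons _ _ _ (Config l R2 M2)) //.
by rewrite /step HPe.
Qed.

(** A frame condition: [s] lists the registers that may have changed. *)
Definition same (s : seq nat) (R R' : nat -> nat) := forall r, r \notin s -> R' r = R r.

Lemma same_sub s s' R R' : all (mem s') s -> same s R R' -> same s' R R'.
Proof.
by move=> /allP H HS r rs'; apply: HS; apply: contra rs' => /H.
Qed.

Ltac frame HS :=
  let r := fresh "r" in let Hr := fresh "Hr" in let E := fresh "E" in
  move=> r Hr; rewrite ?/update;
  repeat (case: eqP => [E|_]; first by move: Hr; rewrite E !inE eqxx ?orbT);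
  by move: r Hr; apply: (same_sub _ HS).

(** * The program *)

(* Registers: 0 = |Q|, 1 = |Sigma|, 2 = |Q|^2, 3 = first free address,
   4 = cursor in the pair table, 5 = base of the pair table, 6 = base of the
   array V of the current round, 7 = base of the last array, 8 = cursor in V,
   9 and 10 = values, 12 to 15 = loop counters, 16 and 17 = cursors in the
   transition table, 18 = state used as a loop counter. *)
Definition combine_instrs (b : bool) : seq instr :=
  if b then [:: Add 9 9 10] else [:: Defs.Sub 10 11 10; Defs.Sub 9 9 10].

(** Mirrors [combine_instrs]; the 1 in [1 - v] is the content of register 11 inside a loop. *)
Definition combine (b : bool) (acc v : nat) : nat :=
  if b then acc + v else acc - (1 - v).

Definition fold_loop b : cmd :=
  For 12 (Blk ([:: Read 10 4; Add 4 4 11; Add 10 10 7; Read 10 10] ++ combine_instrs b)).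

Lemma wp_fold_loop b m R M : R 12 = m ->
  wp (fold_loop b) (fun R' M' => [/\ M' = M,
     R' 9 = foldl (combine b) (R 9) [seq M (M (R 4 + a) + R 7) | a <- iota 0 m],
     R' 4 = R 4 + m & same [:: 4; 9; 10; 11; 12] R R']) (m * 10 + 1) R M.
Proof.
move=> R12.
pose I i (R' M' : nat -> nat) := [/\ M' = M,
     R' 9 = foldl (combine b) (R 9) [seq M (M (R 4 + a) + R 7) | a <- iota 0 i],
     R' 4 = R 4 + i & same [:: 4; 9; 10; 11; 12] R R'].
apply: (@wp_for _ _ _ I 6 m) => //.
  by split=> //; rewrite addn0.
move=> i R1 M1 im [-> H9 H4 HS].
apply: wp_blk; [by case: (b) | by case: (b) |].
have H7 := HS 7 isT.
have Hs : same [:: 4; 9; 10; 11; 12] R1 R1 by [].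
have E x : foldl (combine b) x [seq M (M (R 4 + a) + R 7) | a <- iota 0 i.+1]
  = combine b (foldl (combine b) x [seq M (M (R 4 + a) + R 7) | a <- iota 0 i]) (M (M (R 4 + i) + R 7)).
  by rewrite -[i.+1]addn1 iotaD map_cat foldl_cat.
rewrite /I E -H9 -H4 -H7; case: b {I E H9} => /=; rewrite /update /=; split=> //; split=> //=; rewrite ?H4 ?addnS ?addn0 // ?addn1 //.
all: frame HS.
Qed.

Lemma same_trans s R1 R2 R3 : same s R1 R2 -> same s R2 R3 -> same s R1 R3.
Proof. by move=> H H' r rs; rewrite H' // H. Qed.

Lemma same_refl s R : same s R R.
Proof. by []. Qed.

(** Here [D] is the pair table, [W] the array V and [B] the latest array. On zero sets, [b = true]
    is one step of the recursion for the pairs that Bob cannot take out of V, and [b = false] adds a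
    letter of Alice. *)
Definition layer_val (b : bool) (m : nat) (D W B : nat -> nat) (x : nat) : nat :=
  foldl (combine b) (W x) [seq B (D (x * m + a)) | a <- iota 0 m].

Definition layer_loop b : cmd :=
  For 13 (Seq (Blk [:: Read 9 8; Add 8 8 11; Move 12 1])
         (Seq (fold_loop b) (Blk [:: Const 11 1; Write 3 9; Add 3 3 11]))).

Definition layer b : cmd :=
  Seq (Blk [:: Move 8 6; Move 4 5; Move 13 2])
 (Seq (layer_loop b) (Blk [:: Add 7 7 2])).

Definition layer_regs : seq nat := [:: 3; 4; 7; 8; 9; 10; 11; 12; 13].

Section Layer.
Variables (b : bool) (m N : nat) (D W B : nat -> nat) (R M : nat -> nat).
Hypotheses (R1 : R 1 = m) (R2 : R 2 = N).
Hypothesis sepD : R 5 + N * m <= R 3.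
Hypothesis sepW : R 6 + N <= R 3.
Hypothesis sepB : R 7 + N <= R 3.
Hypothesis memD : forall y, y < N * m -> M (R 5 + y) = D y.
Hypothesis boundD : forall y, y < N * m -> D y < N.
Hypothesis memW : forall x, x < N -> M (R 6 + x) = W x.
Hypothesis memB : forall x, x < N -> M (R 7 + x) = B x.

Lemma fold_layer x (M' : nat -> nat) : (forall y, y < R 3 -> M' y = M y) -> x < N ->
  foldl (combine b) (M' (R 6 + x)) [seq M' (M' (R 5 + x * m + a) + R 7) | a <- iota 0 m]
   = layer_val b m D W B x.
Proof.
move=> HM xN; rewrite /layer_val HM ?memW //; last by lia.
congr foldl; apply/eq_in_map => a; rewrite mem_iota add0n => /andP [_ am].
have xm : x * m + a < N * m.
  have : x.+1 * m <= N * m by rewrite leq_mul2r xN orbT.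
  by rewrite mulSn; lia.
have Hd := boundD xm.
rewrite -addnA [M' (R 5 + _)]HM; last by lia.
by rewrite memD // addnC HM ?memB //; lia.
Qed.

(** All data that are read lie below the free address in register 3, and every write goes at or
    above it, so reads during the pass still see the initial memory. *)
Lemma wp_layer :
  wp (layer b) (fun R' M' => [/\ forall y, y < R 3 -> M' y = M y,
      forall x, x < N -> M' (R 3 + x) = layer_val b m D W B x,
      R' 3 = R 3 + N, R' 7 = R 7 + N & same layer_regs R R'])
    (3 + ((N * (3 + ((m * 10 + 1) + 3) + 4) + 1) + 1)) R M.
Proof.
apply: wp_seq; apply: wp_blk => //=; apply: wp_seq.
pose I x (R' M' : nat -> nat) := [/\ forall y, y < R 3 -> M' y = M y,
      forall x', x' < x -> M' (R 3 + x') = layer_val b m D W B x',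
      [/\ R' 3 = R 3 + x, R' 4 = R 5 + x * m & R' 8 = R 6 + x] & same [:: 3; 4; 8; 9; 10; 11; 12; 13] R R'].
apply: (@wp_for _ _ _ I _ N) => //.
- split=> //; first by rewrite /update /= !addn0.
  by frame (@same_refl [::] R).
- move=> x Rx Mx xN [HM HV [H3 H4 H8] HS].
  apply: wp_seq; apply: wp_blk => //=; apply: wp_seq.
  apply: wp_mono (leqnn _) _; first by apply: (@wp_fold_loop _ m); rewrite /update /= (HS 1 isT).
  move=> R' M' [-> H9 H4' HS']; apply: wp_blk => //=.
  rewrite /update /= in H9 H4'.
  rewrite H4 H8 (HS 7 isT) fold_layer // in H9.
  have H3' : R' 3 = R 3 + x by rewrite (HS' 3 isT) /update /= H3.
  split; first by rewrite /update /= (HS' 13 isT).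
  split.
  + by move=> y yR; rewrite /update /= H3' ltn_eqF ?HM //; lia.
  + move=> x'; rewrite ltnS leq_eqVlt /update /= H3' eqn_add2l.
    by case: eqP => [-> _|_ /= /HV //]; rewrite H9.
  + rewrite /update /= H3' H4' H4 (HS' 8 isT) /update /= H8 mulSn.
    by split; lia.
  + apply: (@same_trans _ _ (update (update (update (update (update Rx 11 1) 13 (N - x.+1)) 9 (Mx (Rx 8))) 8 (Rx 8 + 1)) 12 (Rx 1))).
      by frame HS.
    apply: (same_trans (same_sub _ HS')) => //.
    by frame (@same_refl [::] R').
- move=> R' M' [HM HV [H3 H4 H8] HS]; apply: wp_blk => //=; split=> //.
  + by rewrite /update /= (HS 7 isT) (HS 2 isT) R2.
  + by frame HS.
Qed.

End Layer.

(** * Rounds of the iteration and the final answer *)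

Definition layer_time (m N : nat) : nat :=
  3 + ((N * (3 + ((m * 10 + 1) + 3) + 4) + 1) + 1).

(** The state between two layers. Free memory starts exactly where the last array ends, so adding
    [N] to register 7 makes it point to the array written next. *)
Definition ready (m N : nat) (D W R M : nat -> nat) : Prop :=
  [/\ [/\ R 1 = m, R 2 = N, R 3 = R 7 + N & R 5 + N * m <= R 7],
      forall y, y < N * m -> M (R 5 + y) = D y
    & forall x, x < N -> M (R 7 + x) = W x].

(** Register 6 freezes the base of V while register 7 moves through [k] layers, one for each
    possible letter of Bob; the last layer accounts for the letter of Alice. *)
Definition round (k : nat) : cmd :=
  Seq (Blk [:: Move 6 7; Const 14 k]) (Seq (For 14 (layer true)) (layer false)).

Definition round_val (k m : nat) (D W : nat -> nat) : nat -> nat :=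
  layer_val false m D W (iter k (layer_val true m D W) W).

Definition round_time (k m N : nat) : nat :=
  2 + ((k * (layer_time m N + 4) + 1) + layer_time m N).

Definition round_regs : seq nat := 6 :: 14 :: layer_regs.

Lemma wp_round k m N D W R M :
  (forall y, y < N * m -> D y < N) -> ready m N D W R M ->
  wp (round k) (fun R' M' => ready m N D (round_val k m D W) R' M' /\
                             same round_regs R R') (round_time k m N) R M.
Proof.
move=> boundD [[R1 R2 R3 R5] memD memW].
apply: wp_seq; apply: wp_blk => //=; apply: wp_seq.
(* The last clause keeps V readable at its old base, since each layer of the round starts its folds
   from V. *)
pose I i (R' M' : nat -> nat) :=
  [/\ R' 6 = R 7 /\ same round_regs R R',
      ready m N D (iter i (layer_val true m D W) W) R' M',
      R 7 <= R' 7 & forall x, x < N -> M' (R 7 + x) = W x].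
have layerI b i R1' M1' : R1' 6 = R 7 -> ready m N D (iter i (layer_val true m D W) W) R1' M1' ->
   R 7 <= R1' 7 -> (forall x, x < N -> M1' (R 7 + x) = W x) ->
   wp (layer b) (fun R' M' =>
     [/\ same layer_regs R1' R', ready m N D (layer_val b m D W (iter i (layer_val true m D W) W)) R' M',
        R 7 <= R' 7 & forall x, x < N -> M' (R 7 + x) = W x]) (layer_time m N) R1' M1'.
  move=> H6 [[H1 H2 H3 H5] HD HB] H7 HW.
  apply: wp_mono (leqnn _) _.
    apply: (@wp_layer _ m N D W (iter i (layer_val true m D W) W)) => //; rewrite ?H6 //; lia.
  move=> R' M' [HM HV H3' H7' HS].
  split=> //; last 2 first.
  - by lia.
  - by move=> x xN; rewrite HM ?HW //; lia.
  have E5 := HS 5 isT.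
  split; [split | |].
  - by rewrite (HS 1 isT).
  - by rewrite (HS 2 isT).
  - by lia.
  - by lia.
  - by move=> y yN; rewrite E5 HM ?HD //; lia.
  - by move=> x xN; rewrite H7' -H3 HV.
apply: (@wp_for _ _ _ I _ k) => //.
- by split=> //; split=> //; frame (@same_refl [::] R).
- move=> i Ri Mi ik [[H6 HS] Hr H7 HW].
  apply: wp_mono (leqnn _) _.
    by apply: (layerI true i (update (update Ri 11 1) 14 (k - i.+1))).
  move=> R' M' [HS' Hr' H7' HW'] /=; split; first by rewrite (HS' 14 isT).
  split=> //; split; first by rewrite (HS' 6 isT).
  apply: (same_trans HS); apply: same_trans (same_sub _ HS') => //.
  by frame (@same_refl [::] Ri).
- move=> R' M' [[H6 HS] Hr H7 HW].
  apply: wp_mono (leqnn _) _; first by apply: layerI Hr H7 HW.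
  move=> R'' M'' [HS' Hr' _ _]; split=> //.
  by apply: (same_trans HS); apply: same_sub HS'.
Qed.

Definition main_loop (k : nat) : cmd :=
  Seq (Blk [:: Move 15 2]) (For 15 (round k)).

Lemma wp_main_loop k m N D W R M :
  (forall y, y < N * m -> D y < N) -> ready m N D W R M ->
  wp (main_loop k) (fun R' M' => ready m N D (iter N (round_val k m D) W) R' M')
     (1 + (N * (round_time k m N + 4) + 1)) R M.
Proof.
move=> boundD HR.
apply: wp_seq; apply: wp_blk => //=.
pose I i (R' M' : nat -> nat) := ready m N D (iter i (round_val k m D) W) R' M'.
apply: (@wp_for _ _ _ I _ N) => //; first by case: HR => [[]].
move=> i Ri Mi iN HI.
apply: wp_mono (leqnn _) _; first by apply: wp_round HI.
by move=> R' M' [Hr HS]; rewrite (HS 15 isT).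
Qed.

Definition answer : cmd :=
  Seq (Blk [:: Const 9 0; Move 13 2])
 (Seq (For 13 (Blk [:: Read 10 7; Add 7 7 11; Add 9 9 10]))
      (Blk [:: Const 11 1; Defs.Sub 0 11 9])).

(** A sum of naturals vanishes iff all its terms do, and truncation turns 1 minus the sum into the
    truth value. *)
Lemma wp_answer m N D W R M : ready m N D W R M ->
  wp answer (fun R' M' => R' 0 = [forall x : 'I_N, W x == 0]) (2 + (N * (3 + 4) + 1 + 2)) R M.
Proof.
move=> [[_ R2 _ _] _ HW].
apply: wp_seq; apply: wp_blk => //=; apply: wp_seq.
pose I x (R' M' : nat -> nat) := [/\ M' = M, R' 7 = R 7 + x & R' 9 = \sum_(0 <= y < x) W y].
apply: (@wp_for _ _ _ I _ N) => //.
- by split; rewrite /update ?addn0 ?big_geq.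
- move=> x Rx Mx xN [-> H7 H9]; apply: wp_blk => //=; split; first by [].
  by split=> //; rewrite /update /= ?H7 ?H9 ?addnS ?addn0 // big_nat_recr //= HW.
move=> R' M' [_ _ H9]; apply: wp_blk => //=; rewrite /update /= H9.
case: forallP => [H|H].
  by rewrite big_nat big1 // => y /andP [_ yN]; apply/eqP; exact: (H (Ordinal yN)).
case E : (\sum_(0 <= y < N) W y) => [|s]; last by rewrite subSS sub0n.
case: H => x; move: E; rewrite big_mkord => /eqP; rewrite sum_nat_eq0.
by move/forallP/(_ x).
Qed.

(** * Building the table of the pair automaton *)

(** Repeated addition replaces the missing multiplication, at a cost linear in the counter. *)
Lemma wp_mul r s t R M : uniq [:: r; s; t; 11] ->
  wp (For r (Blk [:: Add s s t])) (fun R' M' => [/\ M' = M,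
     R' s = R s + R r * R t & same [:: r; s; 11] R R']) (R r * (1 + 4) + 1) R M.
Proof.
rewrite /= !inE !negb_or => /and4P [/and3P [rs rt r11] /andP [st s11] t11 _].
pose I i (R' M' : nat -> nat) := [/\ M' = M,
  R' s = R s + i * R t & same [:: r; s; 11] R R'].
apply: (@wp_for _ _ _ I _ (R r)) => //; first by split; rewrite ?addn0.
move=> i Ri Mi ir [-> Hs HS]; apply: wp_blk => //=.
have Ht : Ri t = R t by apply: HS; rewrite !inE !negb_or ![t == _]eq_sym rt st eq_sym t11.
split; first by rewrite /update (negbTE rs) eqxx.
split=> //; last by frame HS.
rewrite /update eqxx [s == r]eq_sym [t == r]eq_sym (negbTE rs) (negbTE rt) (negbTE s11) (negbTE t11).
by rewrite Hs Ht mulSn; lia.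
Qed.

(** The product of the first state by |Q| is formed by a loop counted by register 18. An entry thus
    costs O(|Q|) and the whole table O(|Q|^3 |Sigma|), within the bound. *)
Definition row_loop : cmd :=
  For 12 (Seq (Blk [:: Read 18 16; Read 9 17; Add 16 16 11; Add 17 17 11])
         (Seq (For 18 (Blk [:: Add 9 9 0]))
              (Blk [:: Const 11 1; Write 4 9; Add 4 4 11]))).

Lemma wp_row_loop n m (f g : nat -> nat) R M :
  R 0 = n -> R 12 = m -> R 16 + m <= R 4 -> R 17 + m <= R 4 ->
  (forall a, a < m -> [/\ M (R 16 + a) = f a, M (R 17 + a) = g a & f a < n]) ->
  wp row_loop (fun R' M' => [/\ forall y, (y < R 4) || (R 4 + m <= y) -> M' y = M y,
      forall a, a < m -> M' (R 4 + a) = f a * n + g a,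
      [/\ R' 4 = R 4 + m, R' 16 = R 16 + m & R' 17 = R 17 + m]
    & same [:: 4; 9; 11; 12; 16; 17; 18] R R'])
   (m * (4 + (n * (1 + 4) + 1 + 3) + 4) + 1) R M.
Proof.
move=> R0 R12 R16 R17 Hfg.
pose I i (R' M' : nat -> nat) := [/\ forall y, (y < R 4) || (R 4 + m <= y) -> M' y = M y,
      forall a, a < i -> M' (R 4 + a) = f a * n + g a,
      [/\ R' 4 = R 4 + i, R' 16 = R 16 + i & R' 17 = R 17 + i]
    & same [:: 4; 9; 11; 12; 16; 17; 18] R R'].
apply: (@wp_for _ _ _ I _ m) => //; first by split=> //; rewrite !addn0.
move=> i Ri Mi im [HM HV [H4 H16 H17] HS].
have [Hf Hg fn] := Hfg i im.
apply: wp_seq; apply: wp_blk => //=; apply: wp_seq.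
have E16 : Mi (Ri 16) = f i by rewrite H16 HM // (leq_trans _ R16) // ltn_add2l.
have E17 : Mi (Ri 17) = g i by rewrite H17 HM // (leq_trans _ R17) // ltn_add2l.
apply: wp_mono; [by apply: wp_mul | by rewrite /update /= E16; lia |].
move=> R' M' [-> H9 HS']; apply: wp_blk => //=.
have F4 : R' 4 = R 4 + i by rewrite (HS' 4 isT).
have F9 : R' 9 = f i * n + g i by rewrite H9 /update /= E16 E17 (HS 0 isT) R0; lia.
split; first by rewrite /update /= (HS' 12 isT).
split.
- by move=> y yR; rewrite /update /= F4; case: eqP => [|_]; [lia | exact: HM].
- move=> a; rewrite ltnS leq_eqVlt /update /= F4 eqn_add2l.
  by case: eqP => [-> _|_ /= /HV //]; rewrite F9.
- by rewrite /update /= F4 (HS' 16 isT) (HS' 17 isT) /update /= H16 H17; split; lia.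
- apply: (same_trans HS); apply: (@same_trans _ _ R'); last by frame (@same_refl [::] R').
  apply: (same_trans _ (same_sub _ HS')) => //.
  by frame (@same_refl [::] Ri).
Qed.

Section Init.
Variables (n m : nat) (T : nat -> nat).

(** The address [y] decodes as (p * n + q) * m + a: [y %/ m %/ n] is p, [(y %/ m) %% n] is q and
    [y %% m] is a. *)
Definition pair_entry (y : nat) : nat :=
  T (y %/ m %/ n * m + y %% m) * n + T ((y %/ m) %% n * m + y %% m).

Definition pair_diff (x : nat) : nat := x %/ n != x %% n.

(** Memory holds the input table, then the pair table, then the first array V. The last two are
    filled in parallel, with registers 4 and 3 as cursors, and [c] pairs are finished. *)
Definition pairs_done (c : nat) (R M : nat -> nat) : Prop :=
  [/\ [/\ R 0 = n, R 1 = m & R 2 = n * n],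
      [/\ R 5 = n * m, R 7 = n * m + n * n * m, R 4 = R 5 + c * m & R 3 = R 7 + c],
      forall y, y < n * m -> M y = T y,
      forall y, y < c * m -> M (R 5 + y) = pair_entry y
    & forall x, x < c -> M (R 7 + x) = pair_diff x].

Lemma state_bound p a : p < n -> a < m -> p * m + a < n * m.
Proof.
move=> pn am; have : p.+1 * m <= n * m by rewrite leq_mul2r pn orbT.
by rewrite mulSn; lia.
Qed.

Lemma pair_bound p q : p < n -> q < n -> p * n + q < n * n.
Proof.
move=> pn qn; have : p.+1 * n <= n * n by rewrite leq_mul2r pn orbT.
by rewrite mulSn; lia.
Qed.

Lemma pair_entryE p q a : q < n -> a < m ->
  pair_entry ((p * n + q) * m + a) = T (p * m + a) * n + T (q * m + a).
Proof.
move=> qn am; have n0 : 0 < n by lia. have m0 : 0 < m by lia.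
rewrite /pair_entry.
have -> : ((p * n + q) * m + a) %/ m = p * n + q by rewrite divnMDl // divn_small ?addn0.
by rewrite !modnMDl !modn_small // divnMDl // divn_small ?addn0.
Qed.

Lemma pair_diffE p q : q < n -> pair_diff (p * n + q) = (p != q).
Proof.
move=> qn; have n0 : 0 < n by lia.
by rewrite /pair_diff divnMDl // modnMDl modn_small // divn_small ?addn0.
Qed.

Hypotheses (m_gt0 : 0 < m) (boundT : forall y, y < n * m -> T y < n).

Lemma pair_entry_bound y : y < n * n * m -> pair_entry y < n * n.
Proof.
move=> yb; have n0 : 0 < n by case: (n) yb.
have xb : y %/ m < n * n by rewrite ltn_divLR.
apply: pair_bound; apply: boundT; apply: state_bound; rewrite ?ltn_mod // ltn_divLR //.
Qed.

(** The two truncated differences add up to the distance d between the row cursors, and 1 - (1 - d)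
    reduces it to 0 or 1. The closing subtraction brings cursor 16 back to the start of row p for
    the next q. *)
Definition pair_body : cmd :=
  Seq (Blk [:: Defs.Sub 9 16 17; Defs.Sub 10 17 16; Add 9 9 10; Defs.Sub 9 11 9;
               Defs.Sub 9 11 9; Write 3 9; Add 3 3 11; Move 12 1])
 (Seq row_loop (Blk [:: Defs.Sub 16 16 1])).

Definition pair_time : nat := 8 + (m * (4 + (n * (1 + 4) + 1 + 3) + 4) + 1 + 1).

Lemma wp_pair_body p q R M : p < n -> q < n -> R 11 = 1 ->
  R 16 = p * m -> R 17 = q * m -> pairs_done (p * n + q) R M ->
  wp pair_body (fun R' M' => [/\ pairs_done (p * n + q).+1 R' M',
       R' 16 = p * m, R' 17 = q.+1 * m, R' 13 = R 13 & R' 14 = R 14]) pair_time R M.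
Proof.
move=> pn qn R11 R16 R17 [[R0 R1 R2] [R5 R7 R4 R3] HT HD HW].
have cN := pair_bound pn qn.
have cm : (p * n + q).+1 * m <= n * n * m by rewrite leq_mul2r cN orbT.
rewrite mulSn in cm.
have pm : p.+1 * m <= n * m by rewrite leq_mul2r pn orbT.
have qm : q.+1 * m <= n * m by rewrite leq_mul2r qn orbT.
rewrite !mulSn in pm qm.
apply: wp_seq; apply: wp_blk => //=; apply: wp_seq.
apply: wp_mono (leqnn _) _.
  apply: (@wp_row_loop n m (fun a => T (p * m + a)) (fun a => T (q * m + a))) => //;
    rewrite /update /= ?R16 ?R17 ?R4 ?R5; try lia.
  move=> a am; have ? := state_bound pn am; have ? := state_bound qn am.
  rewrite R3 !ltn_eqF; try lia.
  by rewrite !HT // boundT.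
move=> R' M' [HM HV [H4 H16 H17] HS]; apply: wp_blk => //=.
rewrite /update /= in HM HV H4 H16 H17.
have E0 := HS 0 isT; have E1 := HS 1 isT; have E2 := HS 2 isT; have E5 := HS 5 isT.
have E7 := HS 7 isT; have E3 := HS 3 isT; have E13 := HS 13 isT; have E14 := HS 14 isT.
rewrite /update /= in E0 E1 E2 E5 E7 E3 E13 E14.
clear HS.
rewrite /update /=; split; rewrite ?E13 ?E14 ?H16 ?H17 ?mulSn //; try lia.
split; rewrite /= ?E0 ?E1 ?E2 ?E5 ?E7 ?E3 ?H4 ?R11 //.
- by split; lia.
- by move=> y yT; rewrite HM ?ltn_eqF ?HT //; lia.
- move=> y yc; case: (ltnP y ((p * n + q) * m)) => yc'.
    by rewrite HM ?ltn_eqF ?HD //; lia.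
  rewrite -(subnKC yc') addnA -R4 HV; last by lia.
  by rewrite pair_entryE //; lia.
- move=> x; rewrite ltnS leq_eqVlt => xc; rewrite HM; last by lia.
  rewrite R3 eqn_add2l; case: eqP xc => [-> _|_ /= xc]; last exact: HW.
  rewrite pair_diffE // R11 R16 R17.
  (* As [m] is positive, distinct states have distinct row addresses, so the distance is zero only
     for p = q. *)
  case: (ltngtP p q) => pq; last by rewrite pq !subnn.
    have : p.+1 * m <= q * m by rewrite leq_mul2r pq orbT.
    by rewrite mulSn; lia.
  have : q.+1 * m <= p * m by rewrite leq_mul2r pq orbT.
  by rewrite mulSn; lia.
Qed.

Definition build_loop : cmd :=
  For 14 (Seq (Blk [:: Const 17 0; Move 13 0])
         (Seq (For 13 pair_body) (Blk [:: Add 16 16 1]))).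

Lemma wp_build_loop R M : R 14 = n -> R 16 = 0 -> pairs_done 0 R M ->
  wp build_loop (pairs_done (n * n)) (n * (2 + (n * (pair_time + 4) + 1 + 1) + 4) + 1) R M.
Proof.
move=> R14 R16 H0.
pose I p (R' M' : nat -> nat) := R' 16 = p * m /\ pairs_done (p * n) R' M'.
apply: (@wp_for _ _ _ I _ n) => //; last by move=> ? ? [].
move=> p Rp Mp pn [H16 H]; apply: wp_seq; apply: wp_blk => //=; apply: wp_seq.
pose J q (R' M' : nat -> nat) := [/\ R' 16 = p * m, R' 17 = q * m,
   R' 14 = n - p.+1 & pairs_done (p * n + q) R' M'].
apply: (@wp_for _ _ _ J _ n) => //.
- by case: H => [[]].
- by split=> //; rewrite addn0.
- move=> q Rq Mq qn [G16 G17 G14 G].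
  apply: wp_mono (leqnn _) _; first by apply: (@wp_pair_body p q).
  by move=> R' M' [G' G16' G17' G13' G14']; split=> //; split=> //; rewrite ?G14' // addnS.
- move=> R' M' [G16 G17 G14 G]; apply: wp_blk => //=.
  split=> //; split; last by rewrite mulSn addnC.
  by case: G => [[_ G1 _] _ _ _ _]; rewrite /update /= G16 G1 mulSn addnC.
Qed.

Definition init : cmd :=
  Seq (Blk [:: Const 5 0; Const 2 0; Move 13 0])
 (Seq (For 13 (Blk [:: Add 5 5 1]))
 (Seq (Blk [:: Move 13 0])
 (Seq (For 13 (Blk [:: Add 2 2 0]))
 (Seq (Blk [:: Move 3 5; Move 13 2])
 (Seq (For 13 (Blk [:: Add 3 3 1]))
 (Seq (Blk [:: Move 7 3; Move 4 5; Const 16 0; Move 14 0])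
      build_loop)))))).

Definition init_time : nat :=
  3 + (n * 5 + 1 + (1 + (n * 5 + 1 + (2 + (n * n * 5 + 1 + (4 +
  (n * (2 + (n * (pair_time + 4) + 1 + 1) + 4) + 1))))))).

Lemma wp_init R M : R 0 = n -> R 1 = m -> (forall y, y < n * m -> M y = T y) ->
  wp init (ready m (n * n) pair_entry pair_diff) init_time R M.
Proof.
move=> R0 R1 HT.
apply: wp_seq; apply: wp_blk => //=; apply: wp_seq.
apply: wp_mono; [by apply: wp_mul | by rewrite /update /= R0 |].
move=> Ra Ma [-> Ha5 HSa].
have Ha0 := HSa 0 isT; have Ha1 := HSa 1 isT; have Ha2 := HSa 2 isT.
rewrite /update /= R0 R1 in Ha5 Ha0 Ha1 Ha2.
apply: wp_seq; apply: wp_blk => //=; apply: wp_seq.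
apply: wp_mono; [by apply: wp_mul | by rewrite /update /= Ha0 |].
move=> Rb Mb [-> Hb2 HSb].
have Hb0 := HSb 0 isT; have Hb1 := HSb 1 isT; have Hb5 := HSb 5 isT.
rewrite /update /= Ha0 Ha1 Ha2 Ha5 in Hb5 Hb0 Hb1 Hb2.
apply: wp_seq; apply: wp_blk => //=; apply: wp_seq.
apply: wp_mono; [by apply: wp_mul | by rewrite /update /= Hb2 |].
move=> Rc Mc [-> Hc3 HSc].
have Hc0 := HSc 0 isT; have Hc1 := HSc 1 isT; have Hc5 := HSc 5 isT; have Hc2 := HSc 2 isT.
rewrite /update /= Hb0 Hb1 Hb2 Hb5 in Hc5 Hc0 Hc1 Hc2 Hc3.
apply: wp_seq; apply: wp_blk => //=.
apply: wp_mono (leqnn _) _.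
  apply: wp_build_loop => //.
  by split=> //; rewrite /update /= ?Hc0 ?Hc1 ?Hc2 ?Hc5 ?Hc3 ?addn0.
move=> R' M' [[H0 H1 H2] [H5 H7 H4 H3] _ HD HW].
by split=> //; split=> //; rewrite H5 H7.
Qed.

End Init.

(** * The whole program and its running time *)

Definition decide (k : nat) : cmd := Seq init (Seq (main_loop k) answer).

Definition decide_time (k n m : nat) : nat :=
  init_time n m + ((1 + (n * n * (round_time k m (n * n) + 4) + 1))
                   + (2 + (n * n * (3 + 4) + 1 + 2))).

Lemma wp_decide k n m T R M : 0 < m -> (forall y, y < n * m -> T y < n) ->
  R 0 = n -> R 1 = m -> (forall y, y < n * m -> M y = T y) ->
  wp (decide k) (fun R' M' => R' 0 =
     [forall x : 'I_(n * n), iter (n * n) (round_val k m (pair_entry n m T)) (pair_diff n) x == 0])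
   (decide_time k n m) R M.
Proof.
move=> m0 Tb R0 R1 HT; apply: wp_seq.
apply: wp_mono (leqnn _) _; first by apply: (wp_init m0 Tb).
move=> R' M' HR; apply: wp_seq.
apply: wp_mono (leqnn _) _.
  by apply: wp_main_loop HR => y; apply: pair_entry_bound.
by move=> R'' M'' HR'; apply: wp_answer HR'.
Qed.

Lemma round_time_bound k m N : 0 < m -> 0 < N -> round_time k m N <= (100 * k.+1) * (N * m).
Proof.
move=> m0 N0.
have NP : N <= N * m by rewrite leq_pmulr.
have L : layer_time m N + 4 <= 40 * (N * m) by rewrite /layer_time; lia.
have K : k * (layer_time m N + 4) <= k * (40 * (N * m)) by rewrite leq_mul2l L orbT.
rewrite /round_time mulnS mulnDl; lia.
Qed.

(** The dominant cost is that of n^2 rounds of O(k n^2 m) each; since [n] and [m] are positive,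
    every lower monomial is absorbed into n^4 m by generous constants. *)
Lemma decide_time_bound k n m : 0 < n -> 0 < m ->
  decide_time k n m <= (1000 + 200 * k) * (n ^ 4 * m).
Proof.
move=> n0 m0; have N0 : 0 < n * n by rewrite muln_gt0 n0.
set u := n ^ 4 * m.
have Eu : u = (n * n) * (n * n * m) by rewrite /u !expnS expn0 muln1; lia.
have main : n * n * (round_time k m (n * n) + 4) <= n * n * ((104 * k.+1) * (n * n * m)).
  rewrite leq_mul2l; apply/orP; right.
  by have := round_time_bound k m0 N0; have : 0 < n * n * m; [rewrite muln_gt0 N0|lia].
have {}main : n * n * (round_time k m (n * n) + 4) <= (104 * k.+1) * u.
  by rewrite Eu; apply: leq_trans main _; lia.
(* Each remaining monomial is split into a factor at most n^2 and a factor at most n^2 m. *)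
have mono a b : a <= n * n -> b <= n * n * m -> a * b <= u by move=> ? ?; rewrite Eu leq_mul.
have nN : n <= n * n by rewrite leq_pmulr.
have P0 : 0 < n * n * m by rewrite muln_gt0 N0.
have NP : n * n <= n * n * m by rewrite leq_pmulr.
have u1 := mono 1 1 N0 P0.
have un := mono n 1 nN P0.
have uN := mono (n * n) 1 (leqnn _) P0.
have uNm := mono 1 (n * n * m) N0 (leqnn _).
have uN3 := mono n (n * n * m) nN (leqnn _).
rewrite /decide_time /init_time /pair_time mulnDl; lia.
Qed.

Lemma decide_halts k n m T M : 0 < n -> 0 < m -> (forall y, y < n * m -> T y < n) ->
  (forall y, y < n * m -> M y = T y) ->
  exists2 t, t <= (1000 + 200 * k) * (n ^ 4 * m) &
    halts_in (compile 0 (decide k)) (Config 0 (nth 0 [:: n; m]) M) t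
      [forall x : 'I_(n * n), iter (n * n) (round_val k m (pair_entry n m T)) (pair_diff n) x == 0].
Proof.
move=> n0 m0 Tb HT.
have H := @wp_decide k n m T (nth 0 [:: n; m]) M m0 Tb erefl erefl HT.
have [//|u [R' [M' [Hu E H0]]]] := H (compile 0 (decide k)) 0.
exists u; first by apply: leq_trans Hu (decide_time_bound _ _ _).
exists (Config (0 + csize (decide k)) R' M'); split=> //.
Qed.

(** * The game on pairs of states *)

Section Game.
Variables (Q Sigma : finType) (A : dfa Q Sigma).

Definition pair_step (x : Q * Q) (a : Sigma) : Q * Q := (A x.1 a, A x.2 a).
Definition pair_run (x : Q * Q) (w : seq Sigma) : Q * Q := foldl pair_step x w.

Lemma pair_runE x w : pair_run x w = (run A x.1 w, run A x.2 w).
Proof. by elim: w x => [|a w IH] [p q] //=; rewrite IH. Qed.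

Lemma pair_run_cat x u v : pair_run x (u ++ v) = pair_run (pair_run x u) v.
Proof. exact: foldl_cat. Qed.

Lemma run_set_cat P u v : run_set A P (u ++ v) = run_set A (run_set A P u) v.
Proof.
apply/setP => q; apply/imsetP/imsetP => [[p pP ->]|[_ /imsetP [p pP ->] ->]].
  by exists (run A p u); [apply: imset_f | rewrite /run foldl_cat].
by exists p; rewrite // /run foldl_cat.
Qed.

Definition diag : {set Q * Q} := [set x | x.1 == x.2].

(** Safety is meant for Alice: no word of length at most [i] leads out of [S]. The recursion is the
    one that the layers compute. *)
Fixpoint bob_safe (i : nat) (S : {set Q * Q}) : {set Q * Q} :=
  if i is i'.+1 then [set x in S | [forall a, pair_step x a \in bob_safe i' S]] else S.

Lemma bob_safeP i (S : {set Q * Q}) x :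
  reflect (forall w, size w <= i -> pair_run x w \in S) (x \in bob_safe i S).
Proof.
elim: i x => [|i IH] x /=.
  by apply: (iffP idP) => [xS [|]//|H]; apply: (H [::]).
rewrite inE; apply: (iffP andP) => [[xS /forallP H] [|a w] //= wi|H].
  by move/IH: (H a); apply.
by split; [exact: (H [::]) | apply/forallP => a; apply/IH => w wi; apply: (H (a :: w))].
Qed.

Lemma bob_safe_sub i (S : {set Q * Q}) : bob_safe i S \subset S.
Proof. by apply/subsetP => x /bob_safeP /(_ [::]); apply. Qed.

Lemma bob_safe_mono i (S S' : {set Q * Q}) : S \subset S' -> bob_safe i S \subset bob_safe i S'.
Proof.
move=> /subsetP SS'; apply/subsetP => x /bob_safeP H.
by apply/bob_safeP => w wi; apply/SS'/H.
Qed.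

(** From here on [k] is the greatest length of a word of Bob, so the game is the [k.+1]-game. *)
Variable k : nat.

Definition alice_step (S : {set Q * Q}) : {set Q * Q} :=
  S :|: [set x | [exists a, pair_step x a \in bob_safe k S]].

Definition alice_wins_in (j : nat) : {set Q * Q} := iter j alice_step diag.

Definition alice_region : {set Q * Q} := alice_wins_in #|{: Q * Q}|.

Lemma alice_wins_in_incr i j : i <= j -> alice_wins_in i \subset alice_wins_in j.
Proof.
by move=> /subnK <-; elim: (j - i) => //= d IH; apply: subset_trans IH (subsetUl _ _).
Qed.

(** A monotone operator iterated from the empty set stabilises after as many steps as there are
    pairs, which is [fixsetK]. *)
Lemma alice_regionK : alice_step alice_region = alice_region.
Proof.
(* Joining [diag] makes the iteration start from the empty set: its iterate [j.+1] is
   [alice_wins_in j]. *)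
pose F S := diag :|: alice_step S.
have Fmono : {homo F : S S' / S \subset S'}.
  move=> S S' SS'; apply: setUS; apply: setUSS => //.
  apply/subsetP => x; rewrite !inE => /existsP [a xa]; apply/existsP; exists a.
  exact: (subsetP (bob_safe_mono k SS')).
have E j : iter j.+1 F set0 = alice_wins_in j.
  elim: j => [|j IH].
    rewrite /= /F /alice_step set0U; apply/setUidPl/subsetP => x; rewrite inE => /existsP [a].
    by move/(subsetP (bob_safe_sub _ _)); rewrite inE.
  rewrite iterS IH /F /=; apply/setUidPr.
  by apply: subset_trans (subsetUl _ _); apply: (alice_wins_in_incr (leq0n j)).
have H := fixsetK Fmono; rewrite /fixset in H.
have H1 : alice_region = iter #|{: Q * Q}| F set0 by rewrite /alice_region -E iterS H.
apply/setP => x; apply/idP/idP => [xs|]; last by rewrite inE => ->.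
by rewrite H1 -H -H1 inE xs orbT.
Qed.

Lemma diag_region : diag \subset alice_region.
Proof. exact: (alice_wins_in_incr (leq0n _)). Qed.

Definition off_diag (P : {set Q}) : {set Q * Q} := setX P P :\: diag.

Lemma off_diagP (P : {set Q}) x : reflect [/\ x.1 \in P, x.2 \in P & x.1 != x.2] (x \in off_diag P).
Proof.
rewrite !inE; apply: (iffP and3P) => [[]|[]]; by split.
Qed.

Lemma off_diag_run (P : {set Q}) x w : x \in off_diag P -> pair_run x w \notin diag ->
  pair_run x w \in off_diag (run_set A P w).
Proof.
by move=> /off_diagP [x1 x2 _]; rewrite pair_runE inE /= => ne; apply/off_diagP; split=> //; apply: imset_f.
Qed.

Lemma not_reset_of_pair x w : pair_run x w \notin diag -> ~~ reset_word A w.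
Proof.
rewrite pair_runE inE /=; apply: contra => /cards1P [q E].
have H p : run A p w = q.
  by apply/set1P; rewrite -E; apply: imset_f.
by rewrite !H.
Qed.

(** * Alice's strategy when every pair can be merged *)

Section AliceWins.
Hypothesis all_in : forall x, x \in alice_region.

(** The least number of rounds in which Alice can merge some pair of distinct states of [P]; [find]
    returns the level itself because [iota] starts at 0. *)
Definition rank (P : {set Q}) : nat :=
  find (fun j => off_diag P :&: alice_wins_in j != set0) (iota 0 #|{: Q * Q}|.+1).

Definition alice_choice (P : {set Q}) : option Sigma :=
  [pick a | [exists x in off_diag P, pair_step x a \in bob_safe k (alice_wins_in (rank P).-1)]].

Lemma rank_le P j x : j <= #|{: Q * Q}| -> x \in off_diag P -> x \in alice_wins_in j -> rank P <= j.
Proof.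
move=> jN xP xj; rewrite leqNgt; apply/negP => /(before_find 0).
rewrite nth_iota // add0n => /negbT/negPn/eqP/setP/(_ x).
by rewrite inE xP xj inE.
Qed.

Lemma rankP P : off_diag P != set0 ->
  [/\ 0 < rank P, rank P <= #|{: Q * Q}| & exists2 x, x \in off_diag P & x \in alice_wins_in (rank P)].
Proof.
move=> /set0Pn [y yP].
have le := rank_le (leqnn _) yP (all_in y).
have Hhas : has (fun j => off_diag P :&: alice_wins_in j != set0) (iota 0 #|{: Q * Q}|.+1).
  by rewrite has_find size_iota.
have := nth_find 0 Hhas; rewrite -/(rank P) nth_iota // add0n => /set0Pn [x]; rewrite inE => /andP [xP xr].
split=> //; last by exists x.
rewrite lt0n; apply/eqP => r0; move: xr; rewrite -/(rank P) r0 => xd.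
by case/off_diagP: xP; rewrite inE in xd; rewrite xd.
Qed.

(** By minimality of the rank, a pair realising it is not yet in the previous level, so it entered
    through a letter of Alice. *)
Lemma alice_choiceP P : off_diag P != set0 ->
  exists2 a, alice_choice P = Some a &
  exists2 x, x \in off_diag P & pair_step x a \in bob_safe k (alice_wins_in (rank P).-1).
Proof.
move=> PN; rewrite /alice_choice; case: pickP => [a Ha|H]; first by exists a => //; apply/exists_inP.
have [r0 rN [x xP xr]] := rankP PN.
move: xr; rewrite -{1}(prednK r0) /= inE => /orP [xr|].
  have := rank_le (leq_trans (leq_pred _) rN) xP xr.
  by rewrite leqNgt prednK // leqnn.
rewrite inE => /existsP [a xa].
by have /negbT/exists_inP := H a; case; exists x.
Qed.

(* If no two states of [P] are merged, then the pair which realises [rank P] is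
   mapped to a pair of distinct states that Alice merges in fewer rounds. *)
Lemma potential_decreases P a w : off_diag P != set0 ->
  alice_choice P = Some a -> size w <= k ->
  let P' := run_set A P (a :: w) in
  #|P'| < #|P| \/ (#|P'| <= #|P| /\ rank P' < rank P).
Proof.
move=> PN Ha wk P'; have [b Hb [x xP xs]] := alice_choiceP PN.
have [r0 rN _] := rankP PN.
rewrite Ha in Hb; case: Hb xs => <- /bob_safeP /(_ w wk) xs.
have : #|P'| <= #|P| := leq_imset_card _ _.
rewrite leq_eqVlt => /orP [/eqP eqP'|]; last by left.
right; split; first by rewrite eqP' eqxx.
have inj : {in P &, injective (run A ^~ (a :: w))}.
  by apply/imset_injP; apply/eqP.
have xP' : pair_run x (a :: w) \in off_diag P'.
  apply: off_diag_run => //; rewrite pair_runE inE /=.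
  case/off_diagP: xP => x1 x2 ne.
  by apply: contra ne => /eqP E; apply/eqP; apply: inj.
rewrite -(prednK r0) ltnS; apply: rank_le xP' xs.
exact: leq_trans (leq_pred _) rN.
Qed.

Lemma off_diag_eq0 P : P != set0 -> (off_diag P == set0) = (#|P| == 1).
Proof.
move=> /set0Pn [p pP]; apply/eqP/cards1P => [H|[q E]].
  exists p; apply/setP => q; rewrite inE; apply/idP/eqP => [qP|->//].
  apply/eqP; move/setP/(_ (q, p)): H; rewrite !inE /= pP qP /= andbT.
  by move/negbT/negPn.
apply/setP => x; rewrite in_set0; apply/off_diagP => -[].
by rewrite E !inE => /eqP -> /eqP ->; rewrite eqxx.
Qed.

Variables (q0 : Q) (a0 : Sigma).

(** The strategy depends only on the current image of the state set. By [alice_choiceP], the default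
    [a0] is played only when no two distinct states remain. *)
Definition alice_plays (h : seq (seq Sigma)) : Sigma :=
  odflt a0 (alice_choice (run_set A [set: Q] (flatten h))).

(** Over a move of Alice and the reply of Bob, the pair (cardinality, rank) of the current set
    decreases lexicographically until the set is a singleton. *)
Lemma alice_has_winning_strategy first : has_winning_strategy A k.+1 first Alice.
Proof.
exists alice_plays => sB.
pose P t := run_set A [set: Q] (history first alice_plays sB t).
have Pne t : P t != set0.
  by apply/set0Pn; exists (run A q0 (history first alice_plays sB t)); apply: imset_f.
suff H c r t : mover first t = Alice -> #|P t| <= c -> rank (P t) <= r ->
    alice_wins_play A first alice_plays sB.
  case: first P Pne H => P Pne H; first by apply: (H _ _ 0 erefl (leqnn _) (leqnn _)).
  (* When Bob begins, the descent starts after his first move. *)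
  by apply: (H _ _ 1 erefl (leqnn _) (leqnn _)).
elim: c r t => [|c IHc] r t.
  by move=> _; rewrite leqn0 cards_eq0 (negbTE (Pne t)).
elim: r t => [|r IHr] t tA Pc Pr.
  case: (boolP (off_diag (P t) == set0)) => [|/rankP [r0 _ _]]; last by lia.
  by rewrite off_diag_eq0 // => H; exists t.
case: (boolP (off_diag (P t) == set0)) => [|PN].
  by rewrite off_diag_eq0 // => H; exists t.
have [a Ha _] := alice_choiceP PN.
have tB : mover first t.+1 = Bob by move: tA; rewrite /mover /=; case: odd; case: (first).
have tA2 : mover first t.+2 = Alice by move: tA; rewrite /mover /= negbK.
pose w := val (sB (moves first alice_plays sB t.+1)).
have wk : size w <= k by rewrite -ltnS; exact: (valP (sB _)).
have PE : P t.+2 = run_set A (P t) (a :: w).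
  rewrite /P /history [moves _ _ _ t.+2]/= -/(moves _ _ _ t.+1) -run_set_cat.
  rewrite tB flatten_rcons -/w [moves _ _ _ t.+1]/= tA flatten_rcons -catA /=.
  by rewrite /alice_plays -/(history first alice_plays sB t) -/(P t) Ha.
have := potential_decreases PN Ha wk; rewrite /= -PE => -[lt|[le lt]].
  by apply: (IHc _ t.+2 tA2 _ (leqnn _)); lia.
by apply: (IHr t.+2 tA2); lia.
Qed.

End AliceWins.

(** * Bob's strategy of keeping one pair apart *)

Section BobWins.
Variable x0 : Q * Q.
Hypothesis x0_out : x0 \notin alice_region.

(** The implication makes the choice total: from a pair that Bob cannot take out of [S], the empty
    word is a legal dummy move. *)
Lemma bob_word_exists i S x : exists w : {w : seq Sigma | size w < i.+1},
  (x \notin bob_safe i S) ==> (pair_run x (val w) \notin S).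
Proof.
elim: i x => [|i IH] x; first by exists (exist _ [::] isT); apply/implyP.
rewrite /= inE negb_and; case: (boolP (x \in S)) => [xS|xS]; last first.
  by exists (exist _ [::] isT); apply/implyP.
case: forallP => [_|/forallP/forallPn [a Ha]]; first by exists (exist _ [::] isT).
have [[w wi] /implyP H] := IH (pair_step x a).
by exists (exist _ (a :: w) wi); apply/implyP => _; apply: H.
Qed.

Definition bob_plays (h : seq (seq Sigma)) : {w : seq Sigma | size w < k.+1} :=
  xchoose (bob_word_exists k alice_region (pair_run x0 (flatten h))).

Lemma bob_has_winning_strategy first : has_winning_strategy A k.+1 first Bob.
Proof.
exists bob_plays => sA.
pose x t := pair_run x0 (history first sA bob_plays t).
have safe_sub := subsetP (bob_safe_sub k alice_region).
(* The invariant: the tracked pair is outside the region when Alice moves, and can be taken out of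
   it by a word when Bob moves. Both conditions exclude the diagonal. *)
suff H t : if mover first t is Alice then x t \notin alice_region
           else x t \notin bob_safe k alice_region.
  move=> t; apply: (@not_reset_of_pair x0); rewrite -/(x t).
  have := H t; case: mover; apply: contra; first exact: (subsetP diag_region).
  (* Merged states stay merged under every word. *)
  move=> xd; apply/bob_safeP => w _; apply: (subsetP diag_region).
  by move: xd; rewrite pair_runE !inE /= => /eqP ->.
elim: t => [|t IH].
  by rewrite /x /=; case: mover => //; apply: contra x0_out => /safe_sub.
have E : x t.+1 = pair_run (x t) (match mover first t with
    | Alice => [:: sA (moves first sA bob_plays t)]
    | Bob => val (bob_plays (moves first sA bob_plays t)) end).
  by rewrite /x /history /= flatten_rcons pair_run_cat.
have ME : mover first t.+1 = opponent (mover first t).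
  by rewrite /mover /=; case: odd; case: (first).
rewrite ME E; case: mover IH => /= IH.
  (* As the region is closed under [alice_step], no letter leads from outside it to a pair where Bob
     would be trapped. *)
  apply: contra IH => H; rewrite -alice_regionK inE; apply/orP; right.
  by rewrite inE; apply/existsP; exists (sA (moves first sA bob_plays t)).
exact: (implyP (xchooseP (bob_word_exists k alice_region (x t)))).
Qed.

End BobWins.
End Game.

(** * The two sides agree *)

Lemma nth_allpairs (S T U : Type) (f : S -> T -> U) x0 y0 z0 s t i j :
  i < size s -> j < size t ->
  nth z0 [seq f x y | x <- s, y <- t] (i * size t + j) = f (nth x0 s i) (nth y0 t j).
Proof.
elim: s i => [|x s IH] [|i] //= si tj; rewrite nth_cat size_map.
  by rewrite mul0n add0n tj (nth_map y0).
by rewrite mulSn -addnA ltnNge leq_addr /= addKn IH.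
Qed.

Lemma combine_true_eq0 acc s :
  (foldl (combine true) acc s == 0) = (acc == 0) && all (pred1 0) s.
Proof.
elim: s acc => [|v s IH] acc /=; first by rewrite andbT.
by rewrite IH /= addn_eq0 andbA.
Qed.

(** Each zero in [s] subtracts 1 and nonzero values subtract nothing, so an accumulator at most 1 is
    killed by a single zero. *)
Lemma combine_false_eq0 acc s : acc <= 1 ->
  (foldl (combine false) acc s == 0) = (acc == 0) || has (pred1 0) s.
Proof.
elim: s acc => [|v s IH] acc acc1 /=; first by rewrite orbF.
rewrite IH /=; last by lia.
by rewrite orbA; congr (_ || _); lia.
Qed.

Lemma combine_false_le acc s : foldl (combine false) acc s <= acc.
Proof.
elim: s acc => [|v s IH] acc //=.
by apply: leq_trans (IH _) (leq_subr _ _).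
Qed.

Lemma all_iota_enum_rank (S : finType) (P : pred nat) :
  all P (iota 0 #|S|) = [forall a : S, P (enum_rank a)].
Proof.
apply/allP/forallP => [H a|H i]; first by apply: H; rewrite mem_iota /= ltn_ord.
rewrite mem_iota /= add0n => im; have := H (enum_val (Ordinal im)).
by rewrite enum_valK.
Qed.

Lemma has_iota_enum_rank (S : finType) (P : pred nat) :
  has P (iota 0 #|S|) = [exists a : S, P (enum_rank a)].
Proof.
by apply: negb_inj; rewrite -all_predC all_iota_enum_rank negb_exists.
Qed.

(** * Zero sets of the arrays as sets of pairs *)

Section Correctness.
Variables (Q Sigma : finType) (A : dfa Q Sigma) (k : nat).

Let T := nth 0 (table A).
Let D := pair_entry #|Q| #|Sigma| T.
Let W j := iter j (round_val k #|Sigma| D) (pair_diff #|Q|).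

Definition pair_code (z : Q * Q) : nat := enum_rank z.1 * #|Q| + enum_rank z.2.

Lemma pair_code_bound z : pair_code z < #|Q| * #|Q|.
Proof. exact: pair_bound. Qed.

Lemma pair_code_onto x : x < #|Q| * #|Q| -> exists z, pair_code z = x.
Proof.
move=> xN; have n0 : 0 < #|Q| by case: #|Q| xN.
have x1 : x %/ #|Q| < #|Q| by rewrite ltn_divLR.
have x2 : x %% #|Q| < #|Q| by rewrite ltn_mod.
exists (enum_val (Ordinal x1), enum_val (Ordinal x2)).
by rewrite /pair_code /= !enum_valK -divn_eq.
Qed.

Lemma size_table : size (table A) = #|Q| * #|Sigma|.
Proof. by rewrite size_allpairs -!cardE. Qed.

Lemma table_bound y : y < #|Q| * #|Sigma| -> T y < #|Q|.
Proof.
rewrite -size_table => /(mem_nth 0) /allpairsP [[q a] [_ _ E]].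
by rewrite /T E.
Qed.

Lemma table_entry p a : T (enum_rank p * #|Sigma| + enum_rank a) = enum_rank (A p a).
Proof.
rewrite /T /table {1}(cardE Sigma) (nth_allpairs _ p a) -?cardE //.
by rewrite !nth_enum_rank.
Qed.

Lemma pair_entry_code z a : D (pair_code z * #|Sigma| + enum_rank a) = pair_code (pair_step A z a).
Proof. by rewrite /D pair_entryE // !table_entry. Qed.

Lemma layer_val_true_eq0 (V B : nat -> nat) z :
  (layer_val true #|Sigma| D V B (pair_code z) == 0) =
  (V (pair_code z) == 0) && [forall a, B (pair_code (pair_step A z a)) == 0].
Proof.
rewrite /layer_val combine_true_eq0 all_map all_iota_enum_rank; congr (_ && _).
by apply: eq_forallb => a /=; rewrite pair_entry_code.
Qed.

Lemma layer_val_false_eq0 (V B : nat -> nat) z : V (pair_code z) <= 1 ->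
  (layer_val false #|Sigma| D V B (pair_code z) == 0) =
  (V (pair_code z) == 0) || [exists a, B (pair_code (pair_step A z a)) == 0].
Proof.
move=> V1; rewrite /layer_val combine_false_eq0 // has_map has_iota_enum_rank; congr (_ || _).
by apply: eq_existsb => a /=; rewrite pair_entry_code.
Qed.

Lemma bob_safe_val (V : nat -> nat) (S : {set Q * Q}) : (forall z, (V (pair_code z) == 0) = (z \in S)) ->
  forall z, (iter k (layer_val true #|Sigma| D V) V (pair_code z) == 0) = (z \in bob_safe A k S).
Proof.
move=> HV; elim: (k) => [|i IH] z //=.
rewrite layer_val_true_eq0 HV inE; congr (_ && _).
by apply: eq_forallb => a; rewrite IH.
Qed.

(** The bound by 1 is carried along for [combine_false_eq0]. It persists because a round ends with
    subtractions from V; the intermediate arrays may exceed 1, but only their zeros matter. *)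
Lemma round_iter_val j z :
  W j (pair_code z) <= 1 /\ (W j (pair_code z) == 0) = (z \in alice_wins_in A k j).
Proof.
elim: j z => [|j IH] z.
  rewrite /W /= pair_diffE // inE; split; first exact: leq_b1.
  by rewrite eqb0 negbK (inj_eq val_inj) (inj_eq enum_rank_inj).
have le := combine_false_le; have [W1 Wj] := IH z.
split; first exact: leq_trans (le _ _) W1.
rewrite /W iterS -/(W j) /round_val layer_val_false_eq0 // Wj /= !inE; congr (_ || _).
by apply: eq_existsb => a; apply: bob_safe_val => z'; have [] := IH z'.
Qed.

Lemma all_zero_region :
  [forall x : 'I_(#|Q| * #|Q|), W (#|Q| * #|Q|) x == 0]
   = [forall z, z \in alice_region A k].
Proof.
(* The machine's number of rounds is exactly the number of iterations that defines the region. *)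
rewrite /alice_region card_prod; apply/forallP/forallP => [H z|H x].
  by have [_ <-] := round_iter_val (#|Q| * #|Q|) z; apply: (H (Ordinal (pair_code_bound z))).
by have [z <-] := pair_code_onto (ltn_ord x); have [_ ->] := round_iter_val (#|Q| * #|Q|) z.
Qed.

End Correctness.

Theorem theorem4p8 (k : nat) (hk : 0 < k) :
  exists (P : program) (c : nat),
  forall (Q Sigma : finType) (A : dfa Q Sigma),
    2 < #|Q| -> 0 < #|Sigma| ->
  forall first : player,
  exists (t : nat) (winner : player),
    [/\ halts_in P (input A) t (player_code winner),
        t <= c * (#|Q| ^ 4 * #|Sigma|)
      & has_winning_strategy A k first winner].
Proof.
(* Words of length less than [k.+1] are those of length at most [k], and the constant is the one of
   [decide_time_bound]. *)
case: k hk => // k _; exists (compile 0 (decide k)), (1000 + 200 * k).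
move=> Q Sigma A Q2 S0 first; have Q0 : 0 < #|Q| by lia.
have [t tb Ht] := decide_halts k Q0 S0 (@table_bound _ _ A) (fun y _ => erefl).
rewrite all_zero_region in Ht.
(* If the output bit is 0, some pair lies outside the region, and Bob keeps that pair apart. *)
exists t; case: forallP Ht => [H|/forallP/forallPn [z zN]] Ht.
- exists Alice; split=> //; have /card_gt0P [q0 _] := Q0; have /card_gt0P [a0 _] := S0.
  exact: (alice_has_winning_strategy H q0 a0).
- by exists Bob; split=> //; exact: (bob_has_winning_strategy zN).
Qed.
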